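(* Let $P$ be a finite poset with a maximum element $\hat{1}$ that admits a special partial matching. Let $\theta$ be any automorphism of $P$, and let $P^\theta$ denote the subposet of $P$ induced by the set $\{x \in P \mid \theta(x)=x\}$ of fixed elements of $\theta$. Then $P^\theta$ admits a special partial matching.
   Context: For a poset $Q$, write $x \lessdot y$ ($x$ is covered by $y$) if $x<y$ and there is no $z\in Q$ with $x<z<y$. An automorphism of a poset $P$ is a bijection $\theta\colon P\to P$ such that $\theta$ and $\theta^{-1}$ are order-preserving. Let $Q$ be a finite poset with a maximum $\hat{1}$, with covering relation $\lessdot$ taken in $Q$. A special partial matching (SPM) on $Q$ is a function $M\colon Q\to Q$ such that: (1) $M^2=\mathrm{id}$; (2) $M(\hat{1})\lessdot \hat{1}$; (3) for all $x\in Q$, either $M(x)\lessdot x$, or $x\lessdot M(x)$, or $M(x)=x$; (4) whenever $x\lessdot y$ in $Q$ and $M(x)\neq y$, we have $M(x)<M(y)$. (For $P^\theta$, the covering relation is that of the induced subposet $P^\theta$, and its maximum is $\hat{1}$.) *)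

(* Defs.v *)
From HB Require Import structures.
From mathcomp Require Import all_boot all_order.

Set Implicit Arguments.
Unset Strict Implicit.
Unset Printing Implicit Defensive.

Import Order.TTheory.
Local Open Scope order_scope.

Definition covered {d : Order.disp_t} {Q : porderType d} (x y : Q) : Prop :=
  x < y /\ ~ (exists z : Q, x < z /\ z < y).

(* The maximum of Q is \top. *)
Record special_partial_matching {d : Order.disp_t} {Q : finTPOrderType d}
    (M : Q -> Q) : Prop := SpecialPartialMatching {
  spm_invol : forall x : Q, M (M x) = x;
  spm_top : covered (M \top) \top;
  spm_cases : forall x : Q, [\/ covered (M x) x, covered x (M x) | M x = x];
  spm_lt : forall x y : Q, covered x y -> M x <> y -> M x < M y
}.

Definition admits_spm {d : Order.disp_t} (Q : finTPOrderType d) : Prop :=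
  exists M : Q -> Q, special_partial_matching M.

Record poset_aut {d : Order.disp_t} (P : porderType d) : Type := PosetAut {
  aut_fun :> P -> P;
  aut_inv : P -> P;
  aut_funK : cancel aut_fun aut_inv;
  aut_invK : cancel aut_inv aut_fun;
  aut_fun_homo : {homo aut_fun : x y / x <= y};
  aut_inv_homo : {homo aut_inv : x y / x <= y}
}.

Lemma aut_top (d : Order.disp_t) (P : finTPOrderType d) (theta : poset_aut P) :
  theta \top == \top.
Proof.
rewrite eq_le lex1 /= -{1}(aut_invK theta \top).
exact/aut_fun_homo/lex1.
Qed.

Definition fixed_poset {d : Order.disp_t} {P : finTPOrderType d}
    (theta : poset_aut P) : Type := {x : P | theta x == x}.

Section FixedPoset.
Context {d : Order.disp_t} {P : finTPOrderType d} (theta : poset_aut P).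

HB.instance Definition _ := SubType.on (fixed_poset theta).
HB.instance Definition _ := [Finite of fixed_poset theta by <:].
(* The order is the one induced from P: x <= y is val x <= val y. *)
HB.instance Definition _ :=
  [SubChoice_isSubPOrder of fixed_poset theta by <: with d].

Let fixed_top : fixed_poset theta := exist _ \top (aut_top theta).

Fact fixed_lex1 (x : fixed_poset theta) : x <= fixed_top.
Proof. exact: lex1. Qed.

HB.instance Definition _ :=
  Order.hasTop.Build d (fixed_poset theta) fixed_lex1.

End FixedPoset.

(* Main.v *)
Require Import Defs.
From mathcomp Require Import all_boot all_order.

(** Let [F] be the set of conjugates of the matching [M] by powers of [theta], and consider the orbits of the group generated by [F]. By the lifting property, an element [t] with [f t <= t] for all [f] in [F] has a lower set stable under [F], so it is the maximum of its orbit; dually for minima. Hence every orbit has a maximum and a minimum. A fixed point of [theta] is moved in the same direction by all of [F], so it is the maximum or the minimum of its orbit, and the extrema of its orbit are again fixed by [theta]. Exchanging the two extrema is a special partial matching of the fixed poset. *)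

Set Implicit Arguments.
Unset Strict Implicit.
Unset Printing Implicit Defensive.

Import Order.TTheory.
Local Open Scope order_scope.

(** * Finite posets: induction along covers, and the lifting property *)

Section FinitePoset.
Context {d : Order.disp_t} {P : finPOrderType d}.

(** The size of the strict lower set increases strictly with the element, so any maximizer of it in
    [A] is maximal. *)
Lemma fin_maximal (A : pred P) (x : P) :
  A x -> exists2 m, A m & forall z, A z -> ~~ (m < z).
Proof.
move=> Ax; case: (@arg_maxnP P x A (fun z => #|[set w | w < z]|) Ax) => m Am mmax.
exists m => // z Az; apply/negP => mz.
have := mmax z Az; rewrite /= leqNgt => /negP; apply.
apply/proper_card/properP; split.
  by apply/subsetP => w; rewrite !inE => /lt_trans; apply.
by exists m; rewrite !inE ?ltxx.
Qed.

Lemma fin_minimal (A : pred P) (x : P) :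
  A x -> exists2 m, A m & forall z, A z -> ~~ (z < m).
Proof.
move=> Ax; case: (@arg_minnP P x A (fun z => #|[set w | w < z]|) Ax) => m Am mmin.
exists m => // z Az; apply/negP => zm.
have := mmin z Az; rewrite /= leqNgt => /negP; apply.
apply/proper_card/properP; split.
  by apply/subsetP => w; rewrite !inE => /lt_trans; apply.
by exists z; rewrite !inE ?ltxx.
Qed.

(** A maximal element of the interval from [x] (included) to [y] (excluded) is covered by [y] and
    has a smaller strict lower set. *)
Lemma covered_ind (x : P) (Q : P -> Prop) :
  Q x -> (forall z y, x <= z -> covered z y -> Q z -> Q y) ->
  forall y, x <= y -> Q y.
Proof.
move=> Qx Qcov y.
have [n] := ubnP #|[set w | w < y]|; elim: n => // n IHn in y *.
rewrite ltnS => yn; rewrite le_eqVlt => /predU1P[<- // | xy].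
have [|m /andP[xm my] mmax] := @fin_maximal (fun z => (x <= z) && (z < y)) x.
  by rewrite lexx.
apply: (Qcov m) => //.
  split=> // -[z [mz zy]].
  by have := mmax z; rewrite zy mz (le_trans xm (ltW mz)) => /(_ isT).
apply: IHn => //; apply: leq_trans yn.
apply/proper_card/properP; split.
  by apply/subsetP => w; rewrite !inE => /lt_trans; apply.
by exists m; rewrite !inE ?ltxx.
Qed.

(** The matching axioms in weak inequalities, a form that conjugation by an automorphism
    preserves. *)
Record lifting_involution (f : P -> P) : Prop := LiftingInvolution {
  lifting_invol : involutive f;
  lifting_cmp : forall x, (f x <= x) || (x <= f x);
  lifting_mono : forall x y, covered x y -> f x = y \/ f x <= f y
}.

Lemma lifting_upper (f : P -> P) (x y : P) :
  lifting_involution f -> x <= f x -> x <= y -> x <= f y.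
Proof.
move=> lf xfx; move: y; apply: covered_ind => // z y xz /(lifting_mono lf).
by case=> [<- _|fzy xfz]; rewrite ?(lifting_invol lf) ?(le_trans xfz).
Qed.

Lemma lifting_lower (f : P -> P) (x y : P) :
  lifting_involution f -> f y <= y -> x <= y -> f x <= y.
Proof.
move=> lf fyy xy.
(* Elements between [x] and [y] need not satisfy the hypothesis on [y]; the disjunction passes along
   covers without it. *)
suff [//|fxfy] : f x <= y \/ f x <= f y by apply: le_trans fyy.
move: y xy {fyy}; apply: covered_ind; first by right.
move=> z y _ zy [fxz|fxfz]; first by left; apply: le_trans (ltW zy.1).
case: (lifting_mono lf zy) => [<-|fzy]; first by left.
by right; apply: le_trans fzy.
Qed.

End FinitePoset.

(** * Orbits of a family of lifting involutions, and their extrema *)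

Section Orbits.
Context {d : Order.disp_t} {P : finPOrderType d} (F : {set {ffun P -> P}}).
Hypothesis FP : forall f, f \in F -> lifting_involution f.

Definition fam_rel : rel P := fun x y => [exists f in F, f x == y].
(** A local test on the generators; [is_top_lower] turns it into being the maximum of the orbit. *)
Definition is_top (x : P) := [forall f in F, f x <= x].
Definition is_bot (x : P) := [forall f in F, x <= f x].

Lemma fam_relP (f : {ffun P -> P}) x : f \in F -> fam_rel x (f x).
Proof. by move=> Ff; apply/exists_inP; exists f. Qed.

Lemma fam_connect_sym : connect_sym fam_rel.
Proof.
apply: sym_connect_sym.
suff sub x y : fam_rel x y -> fam_rel y x by move=> x y; apply/idP/idP; apply: sub.
case/exists_inP => f Ff /eqP <-; apply/exists_inP; exists f => //.
by rewrite (lifting_invol (FP Ff)).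
Qed.

Lemma connect_closed (A : P -> Prop) x y :
  (forall f z, f \in F -> A z -> A (f z)) -> A x -> connect fam_rel x y -> A y.
Proof.
move=> AF Ax /connectP[p + ->]; elim: p x Ax => //= z p IHp x Ax /andP[xz].
by apply: IHp; case/exists_inP: xz => f Ff /eqP <-; apply: AF.
Qed.

Lemma is_top_lower t x y : is_top t -> x <= t -> connect fam_rel x y -> y <= t.
Proof.
move=> /forall_inP tt; apply: (@connect_closed (fun z => z <= t)) => f z Ff.
exact: (lifting_lower (FP Ff) (tt f Ff)).
Qed.

Lemma is_bot_upper b x y : is_bot b -> b <= x -> connect fam_rel x y -> b <= y.
Proof.
move=> /forall_inP bb; apply: (@connect_closed (fun z => b <= z)) => f z Ff.
exact: (lifting_upper (FP Ff) (bb f Ff)).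
Qed.

Lemma is_top_uniq t u : is_top t -> is_top u -> connect fam_rel t u -> t = u.
Proof.
move=> tt tu ctu; apply/le_anti/andP; split.
  by rewrite (is_top_lower tu (lexx u)) // fam_connect_sym.
exact: is_top_lower tt (lexx t) ctu.
Qed.

Lemma is_bot_uniq t u : is_bot t -> is_bot u -> connect fam_rel t u -> t = u.
Proof.
move=> bt bu ctu; apply/le_anti/andP; split.
  exact: is_bot_upper bt (lexx t) ctu.
by rewrite (is_bot_upper bu (lexx u)) // fam_connect_sym.
Qed.

(** The default [x] is never returned: the search succeeds by [otopP]. *)
Definition otop x := odflt x [pick t | connect fam_rel x t && is_top t].
Definition obot x := odflt x [pick t | connect fam_rel x t && is_bot t].

(** At a maximal element [m] of the orbit, [f m] is comparable to [m] and cannot exceed it. *)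
Lemma otopP x : connect fam_rel x (otop x) /\ is_top (otop x).
Proof.
rewrite /otop; case: pickP => [t /andP[]//|none].
have [m xm mmax] := fin_maximal (connect0 fam_rel x).
have /negP[] := none m; rewrite xm /=; apply/forall_inP => f Ff.
have := mmax _ (connect_trans xm (connect1 (fam_relP m Ff))).
case/orP: (lifting_cmp (FP Ff) m) => //; rewrite le_eqVlt => /predU1P[<- //|->//].
Qed.

Lemma obotP x : connect fam_rel x (obot x) /\ is_bot (obot x).
Proof.
rewrite /obot; case: pickP => [t /andP[]//|none].
have [m xm mmin] := fin_minimal (connect0 fam_rel x).
have /negP[] := none m; rewrite xm /=; apply/forall_inP => f Ff.
have := mmin _ (connect_trans xm (connect1 (fam_relP m Ff))).
case/orP: (lifting_cmp (FP Ff) m) => //; rewrite le_eqVlt => /predU1P[-> //|->//].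
Qed.

Lemma le_otop x : x <= otop x.
Proof.
have [c t] := otopP x; apply: (is_top_lower t (lexx _)).
by rewrite fam_connect_sym.
Qed.

Lemma ge_obot x : obot x <= x.
Proof.
have [c t] := obotP x; apply: (is_bot_upper t (lexx _)).
by rewrite fam_connect_sym.
Qed.

Lemma otop_eq x t : connect fam_rel x t -> is_top t -> otop x = t.
Proof.
have [c tt] := otopP x => xt t't; apply: is_top_uniq => //.
by apply: connect_trans xt; rewrite fam_connect_sym.
Qed.

Lemma obot_eq x t : connect fam_rel x t -> is_bot t -> obot x = t.
Proof.
have [c tt] := obotP x => xt t't; apply: is_bot_uniq => //.
by apply: connect_trans xt; rewrite fam_connect_sym.
Qed.

Lemma otop_homo : {homo otop : x y / x <= y}.
Proof.
move=> x y xy; apply: is_top_lower (otopP y).2 (le_trans xy (le_otop y)) (otopP x).1.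
Qed.

Lemma obot_homo : {homo obot : x y / x <= y}.
Proof.
move=> x y xy; apply: is_bot_upper (obotP x).2 (le_trans (ge_obot x) xy) (obotP y).1.
Qed.

(** Intended for orbit extrema; a one-element orbit is fixed. *)
Definition oswap x := if is_top x then obot x else otop x.

Lemma oswapK x : is_top x || is_bot x -> oswap (oswap x) = x.
Proof.
rewrite {2}/oswap; case: (boolP (is_top x)) => /= [tx _|_ bx].
  have [c _] := obotP x; rewrite fam_connect_sym in c; rewrite /oswap.
  case: ifP => [tb|_]; last exact: otop_eq.
  have -> := is_top_uniq tb tx c.
  by apply: obot_eq => //; rewrite -(is_top_uniq tb tx c) (obotP x).2.
have [c tt] := otopP x; rewrite /oswap tt.
by apply: obot_eq => //; rewrite fam_connect_sym.
Qed.

(** An orbit maximum [z] above [x] would bound the whole orbit of [x], hence [y]; dually for a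
    minimum. This yields covers among fixed points. *)
Lemma no_extremum_between x y z :
  connect fam_rel x y -> x < z -> z < y -> is_top z || is_bot z -> False.
Proof.
move=> xy xz zy /orP[tz|bz].
  by have := is_top_lower tz (ltW xz) xy; rewrite (lt_geF zy).
have yx : connect fam_rel y x by rewrite fam_connect_sym.
by have := is_bot_upper bz (ltW zy) yx; rewrite (lt_geF xz).
Qed.

Lemma connect_oswap x y : is_top x || is_bot x -> is_top y || is_bot y ->
  connect fam_rel x y -> x < y -> oswap x = y.
Proof.
move=> ex ey xy ltxy; have yx : connect fam_rel y x by rewrite fam_connect_sym.
have ntx : ~~ is_top x.
  by apply/negP => tx; have := is_top_lower tx (lexx x) xy; rewrite (lt_geF ltxy).
have nby : ~~ is_bot y.
  by apply/negP => b_y; have := is_bot_upper b_y (lexx y) yx; rewrite (lt_geF ltxy).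
by rewrite /oswap (negPf ntx); apply: otop_eq => //; rewrite (negPf nby) orbF in ey.
Qed.

(* The third alternative occurs when [x] is an orbit minimum and [y] an orbit maximum. *)
Lemma oswap_lt x y : is_top x || is_bot x -> is_top y || is_bot y -> x < y ->
  [\/ oswap x = y, oswap x < oswap y | x < oswap x < y].
Proof.
move=> ex ey ltxy.
have [xy|nxy] := boolP (connect fam_rel x y).
  by constructor 1; apply: connect_oswap.
(* The orbits are distinct, so weak comparisons between their elements are strict. *)
have diff u v : connect fam_rel x u -> connect fam_rel y v -> u != v.
  move=> xu yv; apply: contraNneq nxy => uv; apply: (connect_trans xu).
  by rewrite uv fam_connect_sym.
have [xt _] := otopP x; have [yt _] := otopP y.
have [xb _] := obotP x; have [yb _] := obotP y.
rewrite /oswap; case: (boolP (is_top x)) => [tx|ntx];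
  case: (boolP (is_top y)) => [ty|nty].
- by constructor 2; rewrite lt_neqAle diff // obot_homo // ltW.
- constructor 2; apply: le_lt_trans (ge_obot x) _.
  exact: lt_le_trans ltxy (le_otop y).
- constructor 3; apply/andP; split.
    rewrite lt_neqAle le_otop andbT; apply: contraNneq ntx => ->.
    exact: (otopP x).2.
  rewrite lt_neqAle diff ?connect0 //=.
  by rewrite (is_top_lower ty (ltW ltxy)).
- by constructor 2; rewrite lt_neqAle diff // otop_homo // ltW.
Qed.

End Orbits.

(** * Conjugates of the matching under the automorphism *)

Section Automorphism.
Context {d : Order.disp_t} {P : finPOrderType d} (theta : poset_aut P).

Lemma le_aut : {mono theta : x y / x <= y}.
Proof.
move=> x y; apply/idP/idP => [/(aut_inv_homo theta)|]; last exact: aut_fun_homo.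
by rewrite !aut_funK.
Qed.

Lemma lt_aut : {mono theta : x y / x < y}.
Proof. exact: leW_mono le_aut. Qed.

Lemma covered_aut_inv x y : covered x y -> covered (aut_inv theta x) (aut_inv theta y).
Proof.
case=> xy no; split; first by rewrite -lt_aut !aut_invK.
case=> z [xz zy]; apply: no; exists (theta z).
by rewrite -[x](aut_invK theta) -[y](aut_invK theta) !lt_aut.
Qed.

Definition aut_conj (f : {ffun P -> P}) : {ffun P -> P} :=
  [ffun x => theta (f (aut_inv theta x))].

Lemma conj_aut f x : aut_conj f (theta x) = theta (f x).
Proof. by rewrite ffunE aut_funK. Qed.

Lemma conj_inj : injective aut_conj.
Proof.
move=> f g fg; apply/ffunP => x; apply: (can_inj (aut_funK theta)).
by rewrite -!conj_aut fg.
Qed.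

Lemma conj_surj f : exists g, aut_conj g = f.
Proof.
exists [ffun x => aut_inv theta (f (theta x))].
by apply/ffunP => x; rewrite !ffunE !aut_invK.
Qed.

Lemma lifting_conj (f : {ffun P -> P}) : lifting_involution f -> lifting_involution (aut_conj f).
Proof.
case=> fK fcmp fmono; split=> [x|x|x y /covered_aut_inv/fmono].
- by rewrite !ffunE aut_funK fK aut_invK.
- by rewrite ffunE -{2 3}[x](aut_invK theta) !le_aut.
rewrite !ffunE => -[->|]; first by left; rewrite aut_invK.
by right; rewrite le_aut.
Qed.

Variable M : {ffun P -> P}.
Hypothesis MP : lifting_involution M.

Definition conjugates := [set f | fconnect aut_conj M f].

Lemma conjugates_iter f : f \in conjugates -> exists k, f = iter k aut_conj M.
Proof. by rewrite inE => /iter_findex <-; eexists. Qed.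

Lemma conjugates_lifting f : f \in conjugates -> lifting_involution f.
Proof.
by case/conjugates_iter => k ->; elim: k => //= k; apply: lifting_conj.
Qed.

(** An injective self-map of a finite type is a permutation, so the forward iterates of [M] form a
    full cycle. *)
Lemma conj_conjugates f : (aut_conj f \in conjugates) = (f \in conjugates).
Proof. by rewrite !inE -same_fconnect1_r //; apply: conj_inj. Qed.

Local Notation R := (fam_rel conjugates).

Lemma connect_aut x y : connect R x y -> connect R (theta x) (theta y).
Proof.
apply: (@connect_closed _ _ conjugates (fun z => connect R (theta x) (theta z))) => //.
move=> f z Ff xz; apply: connect_trans xz (connect1 _).
by rewrite -conj_aut fam_relP // conj_conjugates.
Qed.

Lemma is_top_aut x : is_top conjugates x -> is_top conjugates (theta x).
Proof.
move=> /forall_inP tx; apply/forall_inP => f; have [g <-] := conj_surj f.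
by rewrite conj_conjugates conj_aut le_aut; apply: tx.
Qed.

Lemma is_bot_aut x : is_bot conjugates x -> is_bot conjugates (theta x).
Proof.
move=> /forall_inP tx; apply/forall_inP => f; have [g <-] := conj_surj f.
by rewrite conj_conjugates conj_aut le_aut; apply: tx.
Qed.

Lemma fixed_extremum x : theta x = x -> is_top conjugates x || is_bot conjugates x.
Proof.
move=> fx.
(* The iterates of [theta] fix [x] and preserve order, so all conjugates move [x] to the same side
   as [M] does. *)
have conjx k : iter k aut_conj M x = iter k theta (M x).
  by elim: k => //= k <-; rewrite -[in LHS]fx conj_aut.
have iterx k : iter k theta x = x by elim: k => //= k ->.
have le_iter k : {mono iter k theta : a b / a <= b}.
  by elim: k => //= k IHk a b; rewrite le_aut IHk.
case/orP: (lifting_cmp MP x) => Mx; apply/orP; [left | right];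
  apply/forall_inP => f /conjugates_iter[k ->]; rewrite conjx.
  by rewrite -[leRHS](iterx k) le_iter.
by rewrite -[leLHS](iterx k) le_iter.
Qed.

(** [theta] maps the orbit of a fixed point into itself and extrema to extrema, and these are
    unique. *)
Lemma fixed_oswap x : theta x = x -> theta (oswap conjugates x) = oswap conjugates x.
Proof.
move=> fx; rewrite /oswap; case: ifP => _.
  have [/connect_aut c /is_bot_aut t] := obotP conjugates_lifting x.
  by rewrite fx in c; apply/esym/(obot_eq conjugates_lifting).
have [/connect_aut c /is_top_aut t] := otopP conjugates_lifting x.
by rewrite fx in c; apply/esym/(otop_eq conjugates_lifting).
Qed.

End Automorphism.

(** * The matching on the fixed poset *)

Lemma spm_lifting (d : Order.disp_t) (P : finTPOrderType d) (M : P -> P) :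
  special_partial_matching M -> lifting_involution (finfun M).
Proof.
case=> MK _ Mcases Mlt; split=> [x|x|x y xy]; rewrite !ffunE //.
  by case: (Mcases x) => [[/ltW ->]|[/ltW ->]|->]; rewrite ?orbT ?lexx.
have [->|/eqP nMx] := eqVneq (M x) y; first by left.
by right; apply/ltW/Mlt.
Qed.

Theorem theorem3p1 (d : Order.disp_t) (P : finTPOrderType d)
    (hP : admits_spm P) (theta : poset_aut P) :
  admits_spm (fixed_poset theta).
Proof.
case: hP => M spmM; have MP := spm_lifting spmM.
pose F := conjugates theta (finfun M).
have FP : forall f, f \in F -> lifting_involution f := conjugates_lifting MP.
have fixP (x : fixed_poset theta) : theta (val x) = val x := eqP (valP x).
have ext (x : fixed_poset theta) : is_top F (val x) || is_bot F (val x).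
  exact: fixed_extremum.
pose M' (x : fixed_poset theta) : fixed_poset theta :=
  exist _ (oswap F (val x)) (introT eqP (fixed_oswap MP (fixP x))).
have valM' x : val (M' x) = oswap F (val x) by [].
have valE (x y : fixed_poset theta) : (x < y) = (val x < val y) by [].
have M'cov (x y : fixed_poset theta) :
    connect (fam_rel F) (val x) (val y) -> val x < val y -> covered x y.
  by move=> c xy; split=> // -[z [xz zy]]; apply: no_extremum_between c xz zy (ext z).
exists M'; split.
- by move=> x; apply: val_inj; rewrite !valM' oswapK.
- have c := (obotP FP (\top : P)).1.
  have tt : is_top F \top by apply/forall_inP => f _; apply: lex1.
  have E : val (M' \top) = obot F \top by rewrite valM' /oswap tt.
  apply: M'cov; rewrite E; first by rewrite fam_connect_sym.
  (* Were the top also its orbit minimum, [M \top] would lie above it, against [spm_top]. *)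
  rewrite lt_neqAle lex1 andbT; apply/eqP => bt.
  have /forall_inP/(_ (finfun M)) := (obotP FP (\top : P)).2.
  rewrite inE connect0 => /(_ isT); rewrite bt ffunE.
  by rewrite (lt_geF (spm_top spmM).1).
- move=> x; have [E|ne] := eqVneq (M' x) x; first by constructor 3.
  have := ne; rewrite -val_eqE valM' /oswap.
  case: ifP => [t|t] nex; [constructor 1 | constructor 2]; apply: M'cov;
    rewrite valM' /oswap t.
  + by rewrite fam_connect_sym // (obotP FP _).1.
  + by rewrite lt_neqAle nex ge_obot.
  + exact: (otopP FP _).1.
  + by rewrite lt_neqAle eq_sym nex le_otop.
- move=> x y [xy no] nMx.
  case: (oswap_lt FP (ext x) (ext y) xy) => [E|//|/andP[xM My]].
    by case: nMx; apply: val_inj.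
  (* [M' x] is itself a fixed point, so it would contradict the cover in the fixed poset. *)
  by case: no; exists (M' x).
Qed.
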